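(* Let $n\ge 1$ be an integer, and put $$s_n=\frac{1}{n+1}\sum_{r=0}^{n}\binom{n+1}{n-r}\binom{n+r}{r},\qquad a_n=\sum_{p=2}^{\lceil n/2\rceil}\ \sum_{r=p}^{n-p+1}\binom{r-1}{p-1}\binom{n+1}{r+p}.$$ Then $|\mathcal{DORP}_n|=s_n+a_n$.
   Context: For $n\ge 1$ let $[n]=\{1,\dots,n\}$ with its usual order. A partial transformation of $[n]$ is a function $\rho$ whose domain $\mathrm{Dom}\,\rho$ and image $\mathrm{Im}\,\rho$ are subsets of $[n]$ (the empty map is allowed). Maps are written on the right. $\rho$ is isotone if $x\le y$ implies $x\rho\le y\rho$ for all $x,y\in\mathrm{Dom}\,\rho$; antitone if $x\le y$ implies $x\rho\ge y\rho$ for all $x,y\in\mathrm{Dom}\,\rho$; monotone if it is isotone or antitone; decreasing if $x\rho\le x$ for all $x\in\mathrm{Dom}\,\rho$. $\mathcal{DORP}_n$ denotes the set of all monotone and decreasing partial transformations of $[n]$. Empty sums are $0$. *)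

(* Defs.v *)
From mathcomp Require Import all_boot all_order all_algebra.
Set Implicit Arguments.
Unset Strict Implicit.
Unset Printing Implicit Defensive.

(* The chain [n] = {1, ..., n} is 'I_n = {0, ..., n-1}, shifted
   by one (every notion below only involves comparisons). [rho x = None] means
   that x is not in the domain of rho, [rho x = Some a] that x rho = a. *)
Notation ptrans n := {ffun 'I_n -> option 'I_n}.

Definition isotone n (rho : ptrans n) : bool :=
  [forall x, forall y, forall a, forall b,
    [&& rho x == Some a, rho y == Some b & x <= y] ==> (a <= b)].

Definition antitone n (rho : ptrans n) : bool :=
  [forall x, forall y, forall a, forall b,
    [&& rho x == Some a, rho y == Some b & x <= y] ==> (b <= a)].

Definition monotone n (rho : ptrans n) : bool := isotone rho || antitone rho.

Definition decreasing n (rho : ptrans n) : bool :=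
  [forall x, forall a, (rho x == Some a) ==> (a <= x)].

Definition DORP (n : nat) : {set ptrans n} :=
  [set rho | monotone rho && decreasing rho].

Definition s_ (n : nat) : rat :=
  (n.+1%:R^-1 * \sum_(0 <= r < n.+1) ('C(n.+1, n - r) * 'C(n + r, r))%:R)%R.

(* uphalf n is the ceiling of n / 2; no subtraction below truncates, since
   1 <= p <= n and 1 <= r in the ranges of summation. *)
Definition a_ (n : nat) : nat :=
  \sum_(2 <= p < (uphalf n).+1) \sum_(p <= r < (n - p + 1).+1)
    'C(r - 1, p - 1) * 'C(n.+1, r + p).

(* Main.v *)
(* A monotone map is isotone or antitone, and it is both exactly when it is
   constant on its domain; so |DORP_n| = #isotone + #antitone - #constant, all
   counted among the decreasing maps. Adding to a map with domain inside
   {0, ..., j-1} the new largest point j, with value v, imposes only the bound v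
   on the previous values, which gives a recursion in j and the bound on the
   values. For isotone decreasing maps it is solved, as in the ballot problem, by
     sum_r C(j,r) C(M+r,r) - sum_r C(j-1,r) C(M+1+r,r+2),
   which for j = n, M = n-1 is the Schroeder number s_n. For antitone decreasing
   maps, read from the largest point of [n] downwards, the condition
   x rho <= x is implied for all points by the one for the last point added, so
   the unrestricted numbers sum_r C(j,r) C(M+r,r) are summed over all last points
   and values; by Vandermonde's identity this gives the terms
   C(r-1,p-1) C(n+1,r+p), the nonempty constant maps being
   those with p = 1. *)

Require Import Defs.
From mathcomp Require Import all_boot all_order all_algebra.
From mathcomp Require Import zify ring.
Set Implicit Arguments.
Unset Strict Implicit.
Unset Printing Implicit Defensive.

(** * Recursion on the largest point of the domain *)

(* The maps with domain in {0, ..., j-1}, values in W bounded pointwise by h, and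
   R-related values at increasing arguments; R is <= for isotone maps and = for
   constant maps. *)
Definition chain_maps n (R : rel nat) (h : nat -> nat) (W : pred nat) (j : nat) :
  {set ptrans n} :=
  [set rho : ptrans n |
    [forall x, forall a, (rho x == Some a) ==> [&& x < j, a <= h x & W a]] &&
    [forall x, forall y, forall a, forall b,
      [&& rho x == Some a, rho y == Some b & x < y] ==> R a b]].

Lemma chain_mapsP n (R : rel nat) (h : nat -> nat) (W : pred nat) j (rho : ptrans n) :
  reflect ((forall x a, rho x = Some a -> [/\ x < j, a <= h x & W a]) /\
           (forall x y a b, rho x = Some a -> rho y = Some b -> x < y -> R a b))
          (rho \in chain_maps n R h W j).
Proof.
rewrite inE; apply: (iffP andP) => -[H1 H2]; split.
- by move=> x a e; apply/and3P; move/forallP/(_ x)/forallP/(_ a): H1; rewrite e eqxx.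
- move=> x y a b ex ey xy; move/forallP/(_ x)/forallP/(_ y): H2.
  by move/forallP/(_ a)/forallP/(_ b); rewrite ex ey !eqxx xy.
- by do 2![apply/forallP=> ?]; apply/implyP => /eqP/H1/and3P.
- do 4![apply/forallP=> ?]; apply/implyP => /and3P[/eqP ex /eqP ey xy].
  exact: H2 ex ey xy.
Qed.

Definition extend n (x0 v : 'I_n) (rho : ptrans n) : ptrans n :=
  [ffun x => if x == x0 then Some v else rho x].

Lemma card_split_at n (A : {set ptrans n}) (x0 : 'I_n) :
  #|A| = #|[set rho in A | rho x0 == None]| +
         \sum_(v < n) #|[set rho in A | rho x0 == Some v]|.
Proof.
pose F (o : option 'I_n) := #|[set rho in A | rho x0 == o]|.
have ->: #|A| = \sum_o F o.
  rewrite -sum1_card (partition_big (fun rho : ptrans n => rho x0) predT) //=.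
  by apply: eq_bigr => o _; rewrite sum1dep_card /F; congr #|pred_of_set _|;
    apply/setP=> r; rewrite !inE.
rewrite (bigD1 None) //=; congr (_ + _).
rewrite (reindex_omap Some id) => [|[]] //.
by apply: eq_bigl => v; rewrite eqxx.
Qed.

Lemma card_extend n (A B : {set ptrans n}) (x0 v : 'I_n) :
  (forall rho : ptrans n, rho \in B -> rho x0 = None) ->
  (forall rho : ptrans n, rho x0 = None -> (extend x0 v rho \in A) = (rho \in B)) ->
  #|[set rho in A | rho x0 == Some v]| = #|B|.
Proof.
move=> B0 AB; rewrite -(card_in_imset (f := extend x0 v) (D := B)); last first.
  move=> r1 r2 /B0 e1 /B0 e2 /ffunP e; apply/ffunP => x; move: (e x).
  by rewrite !ffunE; case: eqP => [->|//]; rewrite e1 e2.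
apply: eq_card => rho; rewrite inE; apply/andP/imsetP => [[rA /eqP rx]|[r rB ->]].
  pose r : ptrans n := [ffun x => if x == x0 then None else rho x].
  have rE : rho = extend x0 v r.
    by apply/ffunP => x; rewrite !ffunE; case: eqP => [->|].
  exists r => //; rewrite -AB -?rE //; by rewrite ffunE eqxx.
by rewrite AB ?ffunE ?eqxx //; exact: B0.
Qed.

(** Once j has value v, the constraint [R^~ v] on the earlier values expresses their relation to j
    and implies [W], so the remaining maps again form a [chain_maps] set. *)
Lemma card_chain_mapsS n (R : rel nat) (h : nat -> nat) (W : pred nat) j :
    transitive R -> (forall a v, R a v -> W v -> W a) -> j < n ->
  #|chain_maps n R h W j.+1| = #|chain_maps n R h W j| +
    \sum_(v < n | W v && (v <= h j)) #|chain_maps n R h (R^~ v) j|.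
Proof.
move=> Rtr RW ltjn; pose x0 := Ordinal ltjn.
have out W' (rho : ptrans n) : rho \in chain_maps n R h W' j -> rho x0 = None.
  case/chain_mapsP => H _; case E: (rho x0) => [a|//].
  by case: (H _ _ E); rewrite ltnn.
rewrite (card_split_at _ x0); congr (_ + _).
  apply: eq_card => rho; rewrite inE; apply/andP/idP.
    case=> /chain_mapsP[H1 H2] /eqP e; apply/chain_mapsP; split=> // x a ex.
    case: (H1 x a ex) => xj ah wa; split=> //; rewrite ltn_neqAle -ltnS xj andbT.
    by apply: contra_eqN ex => /eqP xx; rewrite (_ : x = x0) ?e //; apply: val_inj.
  move=> rI; rewrite (out _ _ rI); split=> //; case/chain_mapsP: rI => H1 H2.
  apply/chain_mapsP; split=> // x a /H1[xj ? ?]; split=> //; exact: ltnW.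
rewrite [RHS]big_mkcond; apply: eq_bigr => v _.
case: ifP => [/andP[Wv vh]|nv].
  apply: card_extend => rho; first exact: out.
  move=> r0; apply/chain_mapsP/chain_mapsP => -[H1 H2]; split.
  - move=> x a ex; have xx0 : x != x0 by apply: contra_eqN ex => /eqP->; rewrite r0.
    have ex' : extend x0 v rho x = Some a by rewrite ffunE (negPf xx0).
    case: (H1 x a ex') => xj ah _.
    have xlt : x < j by rewrite ltn_neqAle -ltnS xj andbT; exact: xx0.
    split=> //; apply: (H2 x x0) => //; by rewrite ffunE eqxx.
  - move=> x y a b ex ey xy; apply: (H2 x y) => //; rewrite ffunE; case: eqP => // E.
      by rewrite E r0 in ex.
    by rewrite E r0 in ey.
  - move=> x a; rewrite ffunE; case: eqP => [-> [<-]|_ ex]; first by split.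
    by case: (H1 _ _ ex) => xj ah /RW/(_ Wv); split=> //; apply: ltnW.
  - move=> x y a b; rewrite !ffunE; case: eqP => [->|_] ex.
      case: eqP => [->|_ /H1[yj _ _] /ltnW]; first by rewrite ltnn.
      by rewrite leqNgt yj.
    case: eqP => [_ [<-] _|_ ey]; first by case: (H1 _ _ ex).
    exact: H2 ex ey.
(* A value v that violates [W] or the bound [h j] contributes no map. *)
apply: eq_card0 => rho; rewrite inE; apply/negP => /andP[/chain_mapsP[H _] /eqP e].
by case: (H _ _ e) => _ vh Wv; rewrite vh Wv in nv.
Qed.

Lemma card_chain_maps0 n R h W : #|@chain_maps n R h W 0| = 1.
Proof.
rewrite -(cards1 ([ffun=> None] : ptrans n)); apply: eq_card => rho; rewrite in_set1.
apply/chain_mapsP/eqP => [[H _]|->].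
  by apply/ffunP => x; rewrite ffunE; case E: (rho x) => [a|//]; case: (H _ _ E).
by split=> [x a|x y a b]; rewrite ffunE.
Qed.

(** * Binomial sums *)

Lemma sum_bin_upper p N : \sum_(d < N) 'C(d, p) = 'C(N, p.+1).
Proof. by elim: N => [|N IH]; rewrite ?big_ord0 // big_ord_recr /= IH binS addnC. Qed.

Lemma sum_bin_diag r N : \sum_(v < N) 'C(v + r, r) = 'C(N + r, r.+1).
Proof.
elim: N => [|N IH]; first by rewrite big_ord0 add0n bin_small.
by rewrite big_ord_recr /= IH addSn binS addnC.
Qed.

(** Subsets of {0, ..., N} with r+p+2 elements, sorted by their (r+1)-st element d; d = N would
    leave no room for p+1 larger ones. *)
Lemma sum_bin_conv N r p : \sum_(d < N) 'C(d, r) * 'C(N - d, p.+1) = 'C(N.+1, r + p.+2).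
Proof.
elim: N p => [|N IH] p; first by rewrite big_ord0 bin_small // !addnS.
rewrite big_ord_recr /= subSnn.
under eq_bigr => d _ do rewrite subSn ?(ltnW (ltn_ord d)) // binS mulnDr.
rewrite [in RHS]addnS [RHS]binS -(addnS r p.+1) -IH big_split -addnA /=; congr (_ + _).
case: p => [|p]; last by rewrite IH (@bin_small 1) // muln0 addn0.
under eq_bigr => d _ do rewrite bin0 muln1.
by rewrite sum_bin_upper binn muln1 addn1 binS.
Qed.

(** * Closed forms and their recursions *)

(* The number of isotone partial maps from a j-chain to an (M+1)-chain; the
   summand counts those with r points in the domain. *)
Definition weak_chains j M := \sum_(r < j.+1) 'C(j, r) * 'C(M + r, r).

Lemma weak_chainsS j M :
  weak_chains j.+1 M = weak_chains j M + \sum_(v < M.+1) weak_chains j v.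
Proof.
rewrite /weak_chains exchange_big big_ord_recl /=.
under eq_bigr => r _ do rewrite /bump add1n binS mulnDl.
rewrite big_split /= addnA; congr (_ + _).
  by rewrite big_ord_recr [in RHS]big_ord_recl !bin0 /= bin_small // addn0.
by apply: eq_bigr => r _; rewrite -big_distrr sum_bin_diag addSnnS.
Qed.

(* For M <= j, the number of isotone partial maps from {0, ..., j-1} to
   {0, ..., M} that are not decreasing. *)
Definition excess j M := \sum_(r < j) 'C(j.-1, r) * 'C(M.+1 + r, r.+2).

Lemma excess0 M : excess 0 M = 0.
Proof. exact: big_ord0. Qed.

Lemma excess_bound0 j : excess j 0 = 0.
Proof. by rewrite /excess big1 // => r _; rewrite (@bin_small (1 + r)) ?muln0. Qed.

(** The recursion of [weak_chainsS], so the difference of the two satisfies it too. At j = 0 it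
    breaks down: [excess 1 M] is ['C(M.+1, 2)]. *)
Lemma excessS j M : 0 < j ->
  excess j.+1 M = excess j M + \sum_(v < M.+1) excess j v.
Proof.
case: j => // i _; rewrite /excess exchange_big big_ord_recl /=.
under eq_bigr => r _ do rewrite /bump add1n binS mulnDl.
rewrite big_split /= addnA; congr (_ + _).
  by rewrite big_ord_recr [in RHS]big_ord_recl !bin0 /= (@bin_small i i.+1) // mul0n !addn0.
apply: eq_bigr => r _; rewrite -big_distrr big_ord_recl (@bin_small (1 + r)) //.
under eq_bigr => v _ do rewrite /= /bump add1n !addSnnS.
by rewrite sum_bin_diag addSnnS.
Qed.

Lemma mul_bin_swap j r : 'C(j, r) * 'C(j + r.+1, r.+1) = 'C(j.+1, r.+1) * 'C(j + r.+1, r).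
Proof.
apply/eqP; rewrite -(eqn_pmul2l (ltn0Sn r)) mulnCA mul_bin_left [X in _ == X]mulnA
  -(mul_bin_diag j.+1).
by rewrite addnS subSn ?leq_addl // addnK; apply/eqP; ring.
Qed.

(** Boundary condition of the ballot problem: a decreasing map on {0, ..., j} never takes the value
    j+1, so the difference of the closed forms must not change from M = j to M = j+1. Termwise this
    is Pascal's rule and [mul_bin_swap]. *)
Lemma weak_chains_excess_diag j :
  weak_chains j.+1 j.+1 + excess j.+1 j = weak_chains j.+1 j + excess j.+1 j.+1.
Proof.
rewrite /weak_chains /excess [X in X + _]big_ord_recl [X in _ = X + _]big_ord_recl !bin0 /= -!addnA; congr (_ + _).
rewrite -!big_split; apply: eq_bigr => r _ /=; rewrite /bump !add1n.
rewrite addSn binS mulnDr -addnA; congr (_ + _).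
rewrite -mul_bin_swap [in RHS]addSn binS mulnDr addnC addSnnS //.
Qed.

Lemma mul_bin_schroder k r :
  'C(k.+2, r.+2) * 'C(k.+1 + r.+1, r.+1) + k.+2 * ('C(k, r) * 'C(k.+1 + r, r.+2)) =
  k.+2 * ('C(k.+1, r.+1) * 'C(k + r.+1, r.+1)).
Proof.
have e1 := mul_bin_diag k.+2 r.+1; have e2 := mul_bin_diag k.+1 r.
have e3 := mul_bin_left (k + r.+1) r.+1; have e4 := mul_bin_down (k.+1 + r.+1) r.+1.
rewrite addnK /= in e1 e2 e3; rewrite addnK addSn /= in e4; rewrite (addSnnS k r) addSn.
(* These factors clear the denominators when e1 to e4 express all binomials through ['C(k, r)] and
   ['C(k + r.+1, r.+1)]. *)
apply/eqP; rewrite -(eqn_pmul2l (isT : 0 < r.+1 * r.+2 * k.+1)); apply/eqP.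
move: e1 e2 e3 e4.
set P := 'C(k.+2, _); set Q := 'C((k + _).+1, _); set A := 'C(k, _).
set D := 'C(k + _, r.+2); set E := 'C(k.+1, _); set B := 'C(k + _, _).
move=> e1 e2 e3 e4.
have -> : r.+1 * r.+2 * k.+1 * (P * Q + k.+2 * (A * D)) =
   r.+1 * (r.+2 * P) * (k.+1 * Q) + k.+1 * k.+2 * A * r.+1 * (r.+2 * D) by ring.
have -> : r.+1 * r.+2 * k.+1 * (k.+2 * (E * B)) = r.+2 * k.+1 * k.+2 * (r.+1 * E) * B by ring.
rewrite -e1 -e2 e3 -e4 [r.+1 * _]mulnCA -e2; ring.
Qed.

(** * Isotone decreasing maps *)

Lemma sum_ord_le n m (F : nat -> nat) : m < n ->
  \sum_(v < n | v <= m) F v = \sum_(v < m.+1) F v.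
Proof. by move=> mn; rewrite (big_ord_widen _ F mn). Qed.

Lemma card_isotone_chains n j M : j <= n -> M <= j -> M < n ->
  #|@chain_maps n leq id (leq^~ M) j| + excess j M = weak_chains j M.
Proof.
elim: j M => [|j IH] M jn; first by case: M => // _ _;
  rewrite card_chain_maps0 excess0 /weak_chains big_ord1.
(* The new point j has value at most [h j], which is j; hence the [minn]. *)
have step N : N < n -> #|@chain_maps n leq id (leq^~ N) j.+1| =
   #|@chain_maps n leq id (leq^~ N) j| +
     \sum_(v < (minn N j).+1) #|@chain_maps n leq id (leq^~ (v : nat)) j|.
  move=> Nn; rewrite card_chain_mapsS //; last by move=> a v; apply: leq_trans.
    congr (_ + _); rewrite -(@sum_ord_le n _ (fun v => #|@chain_maps n leq id (leq^~ v) j|)).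
      by apply: eq_bigl => v; rewrite leq_min.
    by rewrite ltnNge leq_min negb_and -!ltnNge Nn.
  exact: leq_trans.
have low N : N <= j -> #|@chain_maps n leq id (leq^~ N) j.+1| + excess j.+1 N = weak_chains j.+1 N.
  move=> Nj; rewrite step ?(leq_ltn_trans Nj) // (minn_idPl Nj) weak_chainsS.
  case: j jn IH {step} Nj => [|j] jn IH Nj.
    move: Nj; rewrite leqn0 => /eqP ->; rewrite excess_bound0 addn0 !big_ord1.
    by rewrite -(IH 0) // excess0 addn0.
  rewrite excessS // addnACA IH ?(ltnW jn) ?(leq_ltn_trans Nj) // -big_split.
  congr (_ + _); apply: eq_bigr => v _ /=; have vj : v <= j.+1 by apply: leq_trans Nj;
    rewrite -ltnS.
  by apply: IH; rewrite ?(ltnW jn) ?(leq_ltn_trans vj).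
rewrite leq_eqVlt ltnS => /orP[/eqP-> jn1|/low//].
(* For M = j+1 the count equals that for M = j: the point j takes the same values, and the earlier
   values are below j under either bound. *)
apply/eqP; rewrite -(eqn_add2r (excess j.+1 j)) weak_chains_excess_diag -low // addnAC eqn_add2r eqn_add2r.
rewrite !step // ?(ltnW jn1) // minnn (minn_idPr (leqnSn j)) eqn_add2r;
  apply/eqP/eq_card => rho.
apply/chain_mapsP/chain_mapsP => -[H1 H2]; split=> // x a /H1[xj ax aj]; split=> //.
  exact: leq_trans ax (ltnW xj).
exact: leqW.
Qed.

(** * Antitone and constant maps, read from the largest point downwards *)

Lemma sum_ord_widen0 m n (F : nat -> nat) : m <= n -> (forall i, m <= i -> F i = 0) ->
  \sum_(i < n) F i = \sum_(i < m) F i.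
Proof.
move=> mn F0; rewrite (big_ord_widen _ F mn) [RHS]big_mkcond; apply: eq_bigr => i _.
by case: ltnP => // /F0.
Qed.

Lemma sum_nat_shrink M m n N (F : nat -> nat) : M <= m -> m <= n -> n <= N ->
    (forall i, M <= i -> (i < m) || (n <= i) -> F i = 0) ->
  \sum_(M <= i < N) F i = \sum_(m <= i < n) F i.
Proof.
move=> Mm mn nN F0; rewrite (big_cat_nat Mm (leq_trans mn nN)) (big_cat_nat mn nN) /=.
rewrite big1_seq => [|i /andP[_]]; last first.
  by rewrite mem_index_iota => /andP[Mi im]; rewrite F0 ?im.
rewrite add0n [X in _ + X]big1_seq ?addn0 // => i /andP[_].
rewrite mem_index_iota => /andP[ni _]; rewrite F0 ?ni ?orbT //.
exact: leq_trans Mm (leq_trans mn ni).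
Qed.

(** For x < j the bound n-1-x is at least n-j, hence at least M, so it is automatic and the
    recursion is that of [weak_chainsS]. *)
Lemma card_antitone_chains n j M : j <= n -> M <= n - j -> M < n ->
  #|@chain_maps n leq (fun x => n.-1 - x) (leq^~ M) j| = weak_chains j M.
Proof.
elim: j M => [|j IH] M jn Mj Mn; first by rewrite card_chain_maps0 /weak_chains big_ord1 !bin0.
rewrite card_chain_mapsS ?weak_chainsS //; last by move=> a v; apply: leq_trans.
  rewrite IH ?(ltnW jn) //; last by lia.
  congr (_ + _); rewrite -(sum_ord_le (weak_chains j) Mn).
  apply: eq_big => [v|v /andP[vM _]]; last by apply: IH => //; lia.
  by rewrite andb_idr // => vM; lia.
exact: leq_trans.
Qed.

(** Only the domain is free; [weak_chains j 0] is 2^j. *)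
Lemma card_constant_chains n j M : j <= n -> M <= n - j -> M < n ->
  #|@chain_maps n eq_op (fun x => n.-1 - x) (eq_op^~ M) j| = weak_chains j 0.
Proof.
elim: j M => [|j IH] M jn Mj Mn; first by rewrite card_chain_maps0 /weak_chains big_ord1.
rewrite card_chain_mapsS ?weak_chainsS //; last by move=> a v /eqP->.
  have Mj' : M <= n - j by lia.
  rewrite IH ?(ltnW jn) ?big_ord1 // (big_pred1 (Ordinal Mn)) ?IH ?(ltnW jn) // => v.
  by rewrite /= andb_idr // => /eqP->; lia.
by move=> ? ? ? /eqP->.
Qed.

Lemma card_chain_maps_top n (R : rel nat) (h : nat -> nat) j : transitive R -> j <= n ->
  #|@chain_maps n R h predT j| =
  1 + \sum_(i < j) \sum_(v < n | v <= h i) #|@chain_maps n R h (R^~ (v : nat)) i|.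
Proof.
move=> Rtr; elim: j => [|j IH] jn; first by rewrite card_chain_maps0 big_ord0.
by rewrite card_chain_mapsS // IH ?(ltnW jn) // big_ord_recr addnA.
Qed.

Lemma card_antitone_chains_top n : #|@chain_maps n leq (fun x => n.-1 - x) predT n| =
  1 + \sum_(r < n) \sum_(p < n.+1) 'C(r, p) * 'C(n.+1, r + p.+2).
Proof.
rewrite card_chain_maps_top //; last exact: leq_trans.
congr (_ + _).
transitivity (\sum_(i < n) \sum_(r < n) 'C(i, r) * 'C(n - i + r, r.+1)).
  apply: eq_bigr => i _; have ilt := ltn_ord i.
  transitivity (\sum_(v < n - i) weak_chains i v).
    have le : (n.-1 - i).+1 = n - i by lia.
    rewrite -le -(@sum_ord_le n) ?le; last by lia.
    by apply: eq_bigr => v vi; rewrite card_antitone_chains //; lia.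
  rewrite /weak_chains exchange_big /=.
  rewrite (sum_ord_widen0 (F := fun r => 'C(i, r) * 'C(n - i + r, r.+1)) ilt).
    by apply: eq_bigr => r _; rewrite -big_distrr sum_bin_diag.
  by move=> r ir; rewrite bin_small.
rewrite exchange_big; apply: eq_bigr => r _ /=.
(* Vandermonde isolates the dependence on i in ['C(n - i, p.+1)], ready for [sum_bin_conv] against
   ['C(i, r)]. *)
have vdm i : 'C(n - i + r, r.+1) = \sum_(p < r.+1) 'C(n - i, p.+1) * 'C(r, p).
  rewrite -(binomial.Vandermonde (n - i)) big_ord_recl subn0 (@bin_small r r.+1) // muln0 add0n.
  by apply: eq_bigr => p _; rewrite lift0 subSS bin_sub // -ltnS.
rewrite (sum_ord_widen0 (m := r.+1) (F := fun p => 'C(r, p) * 'C(n.+1, r + p.+2))); first last.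
- by move=> p rp; rewrite bin_small.
- exact: leqW.
under eq_bigr => i _ do rewrite vdm big_distrr.
rewrite exchange_big; apply: eq_bigr => p _ /=; rewrite -sum_bin_conv big_distrr.
by apply: eq_bigr => i _ /=; ring.
Qed.

Lemma card_constant_chains_top n : #|@chain_maps n eq_op (fun x => n.-1 - x) predT n| =
  1 + \sum_(r < n) 'C(n.+1, r.+2).
Proof.
rewrite card_chain_maps_top //; last by move=> ? ? ? /eqP->.
congr (_ + _).
(* The n-i possible values are written ['C(n - i, 1)] to match [sum_bin_conv] at p = 0. *)
transitivity (\sum_(i < n) \sum_(r < n) 'C(i, r) * 'C(n - i, 1)).
  apply: eq_bigr => i _; have ilt := ltn_ord i.
  transitivity (\sum_(v < n - i) weak_chains i 0).
    have le : (n.-1 - i).+1 = n - i by lia.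
    rewrite -le -(@sum_ord_le n _ (fun=> weak_chains i 0)) ?le; last by lia.
    by apply: eq_bigr => v vi; rewrite card_constant_chains //; lia.
  rewrite sum_nat_const card_ord -big_distrl bin1 mulnC; congr (_ * _).
  rewrite (sum_ord_widen0 (F := fun r => 'C(i, r)) ilt).
    by apply: eq_bigr => r _; rewrite binn muln1.
  by move=> r ir; rewrite bin_small.
by rewrite exchange_big; apply: eq_bigr => r _; rewrite sum_bin_conv addn2.
Qed.

(** * The double sum [a_] *)

(** Shift r by 1 and p by 2. In the original indices the added terms vanish: the first binomial if r
    < p, the second if r+p > n+1, which r >= p forces once p exceeds the ceiling of n/2. *)
Lemma a_E n : a_ n = \sum_(r < n) \sum_(p < n) 'C(r, p.+1) * 'C(n.+1, r + p.+3).
Proof.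
case: n => [|n]; first by rewrite /a_ big_geq // big_ord0.
have upn := uphalf_half n.+1; have hn := odd_double_half n.+1.
rewrite /a_ exchange_big -(big_mkord predT (fun p => \sum_(r < n.+1) 'C(r, p.+1) * 'C(n.+2, r + p.+3))).
rewrite -(@sum_nat_shrink 2 2 _ n.+3); first last.
- move=> p p2 /=; rewrite ltnNge p2 /= => hp; rewrite big1_seq // => r.
  rewrite mem_index_iota => /andP[_ /andP[pr _]]; rewrite (@bin_small n.+2) ?muln0 //; lia.
- lia.
- lia.
- by [].
rewrite !big_add1 /=; apply: eq_big_nat => p /andP[_ pn].
rewrite -(big_mkord predT (fun r => 'C(r, p.+1) * 'C(n.+2, r + p.+3))).
have shift : \sum_(0 <= i < n.+1) 'C(i, p.+1) * 'C(n.+2, i + p.+3) =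
    \sum_(1 <= r < n.+2) 'C(r - 1, p.+2 - 1) * 'C(n.+2, r + p.+2).
  by rewrite big_add1; apply: eq_big_nat => r _; rewrite !subn1 addSnnS.
rewrite shift {shift}; case: (leqP p.+2.*2 n.+2) => hp.
  rewrite -(@sum_nat_shrink 1 _ _ n.+2) //; [lia|lia|].
  move=> r r1 /orP[rp|nr]; first by rewrite bin_small //; lia.
  by rewrite (@bin_small n.+2) ?muln0 //; lia.
rewrite !big1_seq // => r; rewrite mem_index_iota => /andP[_ /andP[pr _]].
  case: (leqP p.+2 r) => rp; last by rewrite bin_small //; lia.
  by rewrite (@bin_small n.+2) ?muln0 //; lia.
by rewrite (@bin_small n.+2) ?muln0 //; lia.
Qed.

Lemma card_chain_maps_antitone n :
  #|@chain_maps n leq (fun x => n.-1 - x) predT n| =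
  #|@chain_maps n eq_op (fun x => n.-1 - x) predT n| + a_ n.
Proof.
rewrite card_antitone_chains_top card_constant_chains_top a_E -addnA -big_split.
congr (_ + _); apply: eq_bigr => r _; rewrite big_ord_recl bin0 mul1n addn2.
by congr (_ + _); apply: eq_bigr => p _; rewrite lift0.
Qed.

(** * From the defining predicates to chain maps *)

Lemma isotoneP n (rho : ptrans n) :
  reflect (forall x y a b, rho x = Some a -> rho y = Some b -> x <= y -> a <= b)
          (isotone rho).
Proof.
apply: (iffP idP) => [H x y a b ex ey xy | H].
  move/forallP/(_ x)/forallP/(_ y)/forallP/(_ a)/forallP/(_ b): H.
  by rewrite ex ey !eqxx xy.
do 4![apply/forallP=> ?]; apply/implyP => /and3P[/eqP ex /eqP ey xy].
exact: H ex ey xy.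
Qed.

Lemma antitoneP n (rho : ptrans n) :
  reflect (forall x y a b, rho x = Some a -> rho y = Some b -> x <= y -> b <= a)
          (antitone rho).
Proof.
apply: (iffP idP) => [H x y a b ex ey xy | H].
  move/forallP/(_ x)/forallP/(_ y)/forallP/(_ a)/forallP/(_ b): H.
  by rewrite ex ey !eqxx xy.
do 4![apply/forallP=> ?]; apply/implyP => /and3P[/eqP ex /eqP ey xy].
exact: H ex ey xy.
Qed.

Lemma decreasingP n (rho : ptrans n) :
  reflect (forall x a, rho x = Some a -> a <= x) (decreasing rho).
Proof.
apply: (iffP idP) => [H x a ex | H].
  by move/forallP/(_ x)/forallP/(_ a): H; rewrite ex eqxx.
by do 2![apply/forallP=> ?]; apply/implyP => /eqP/H.
Qed.

(** Reversing the domain makes antitone maps isotone and turns the bound x into n-1-x. *)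
Definition flip n (rho : ptrans n) : ptrans n := [ffun x => rho (rev_ord x)].

Lemma flip_inj n : injective (@flip n).
Proof.
move=> r1 r2 /ffunP e; apply/ffunP => x.
by have := e (rev_ord x); rewrite !ffunE rev_ordK.
Qed.

Lemma card_isotone_decreasing n : 
  #|[set rho : ptrans n | isotone rho && decreasing rho]| =
  #|@chain_maps n leq id (leq^~ n.-1) n|.
Proof.
apply: eq_card => rho; rewrite inE.
apply/andP/chain_mapsP => [[/isotoneP ri /decreasingP rd]|[rd ri]].
  split=> [x a ex|x y a b ex ey /ltnW]; last exact: ri ex ey.
  split; [by [] | exact: rd | by have := ltn_ord a; lia].
split; [apply/isotoneP|by apply/decreasingP => x a /rd[]].
move=> x y a b ex ey; rewrite leq_eqVlt => /orP[/eqP/val_inj xy|]; last exact: ri ex ey.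
by move: ex; rewrite xy ey => -[->].
Qed.

Lemma card_antitone_decreasing n :
  #|[set rho : ptrans n | antitone rho && decreasing rho]| =
  #|@chain_maps n leq (fun x => n.-1 - x) predT n|.
Proof.
rewrite -[RHS](card_preimset _ (@flip_inj n)); apply: eq_card => rho;
  rewrite [in LHS]inE [in RHS]inE.
apply/andP/chain_mapsP => [[/antitoneP ra /decreasingP rd]|[rd ra]].
  split=> [x a|x y a b]; rewrite !ffunE.
    by move=> /rd /=; split=> //; lia.
  by move=> ex ey xy; apply: ra ey ex _ => /=; lia.
have flipE x : rho x = flip rho (rev_ord x) by rewrite ffunE rev_ordK.
split; last by apply/decreasingP => x a; rewrite flipE => /rd[_ /= ax _];
  have := ltn_ord x; lia.
apply/antitoneP => x y a b ex ey; rewrite leq_eqVlt => /orP[/eqP/val_inj xy|xy].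
  by move: ex; rewrite xy ey => -[->].
by rewrite !flipE in ex ey; apply: ra ey ex _ => /=; have := ltn_ord y; lia.
Qed.

Lemma card_constant_decreasing n :
  #|[set rho : ptrans n | [&& isotone rho, antitone rho & decreasing rho]]| =
  #|@chain_maps n eq_op (fun x => n.-1 - x) predT n|.
Proof.
rewrite -[RHS](card_preimset _ (@flip_inj n)); apply: eq_card => rho;
  rewrite [in LHS]inE [in RHS]inE.
apply/and3P/chain_mapsP => [[/isotoneP ri /antitoneP ra /decreasingP rd]|[rd rc]].
  split=> [x a|x y a b]; rewrite !ffunE.
    by move=> /rd /=; split=> //; lia.
  move=> ex ey xy; rewrite eqn_leq (ra _ _ _ _ ey ex) ?(ri _ _ _ _ ey ex) //=; lia.
have flipE x : rho x = flip rho (rev_ord x) by rewrite ffunE rev_ordK.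
have const x y a b : rho x = Some a -> rho y = Some b -> x <= y -> a = b.
  move=> ex ey; rewrite leq_eqVlt => /orP[/eqP/val_inj xy|xy].
    by move: ex; rewrite xy ey => -[->].
  rewrite !flipE in ex ey; apply/val_inj/esym/eqP; apply: rc ey ex _ => /=.
  by have := ltn_ord y; lia.
split; last by apply/decreasingP => x a; rewrite flipE => /rd[_ /= ax _];
  have := ltn_ord x; lia.
- by apply/isotoneP => x y a b ex ey /(const _ _ _ _ ex ey)->.
- by apply/antitoneP => x y a b ex ey /(const _ _ _ _ ex ey)->.
Qed.

(** * Inclusion-exclusion and the Schroeder number *)

Lemma card_DORP n : #|DORP n| = #|@chain_maps n leq id (leq^~ n.-1) n| + a_ n.
Proof.
pose I := [set rho : ptrans n | isotone rho && decreasing rho].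
pose A := [set rho : ptrans n | antitone rho && decreasing rho].
have -> : DORP n = I :|: A.
  by apply/setP => rho; rewrite !inE /monotone andb_orl.
have IA : #|I :&: A| = #|@chain_maps n eq_op (fun x => n.-1 - x) predT n|.
  rewrite -card_constant_decreasing; apply: eq_card => rho; rewrite !inE.
  by case: isotone; case: antitone; case: decreasing.
rewrite cardsU IA /I /A card_isotone_decreasing card_antitone_decreasing.
by rewrite card_chain_maps_antitone addnCA addKn.
Qed.

(** For n = k+1 the first sum is (n+1) s_n. By symmetry ['C(k.+2, k.+1 - r)] is ['C(k.+2, r.+1)];
    the terms r = 0 agree and the others are [mul_bin_schroder]. *)
Lemma schroder_sum k :
  \sum_(r < k.+2) 'C(k.+2, k.+1 - r) * 'C(k.+1 + r, r) + k.+2 * excess k.+1 k =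
  k.+2 * weak_chains k.+1 k.
Proof.
rewrite /weak_chains /excess [X in X + _]big_ord_recl [X in _ = _ * X]big_ord_recl.
rewrite !bin0 subn0 binSn mulnDr -addnA; congr (_ + _).
rewrite !big_distrr -big_split; apply: eq_bigr => r _ /=; rewrite /bump !add1n.
rewrite -mul_bin_schroder; congr (_ * _ + _).
rewrite -(bin_sub (n := k.+2) (m := r.+2)) //; exact: ltn_ord r.
Qed.

Local Open Scope ring_scope.
Import GRing.Theory Num.Theory.

Theorem theorem1p7 (n : nat) (hn : (1 <= n)%N) :
  #|DORP n|%:R = s_ n + (a_ n)%:R.
Proof.
case: n hn => [//|k] _; rewrite card_DORP natrD; congr (_ + _).
have E := @card_isotone_chains k.+1 k.+1 k (leqnn _) (leqnSn _) (leqnn _).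
(* Replacing [weak_chains] by the count plus [excess] cancels the excess and leaves (n+1) s_n =
   (n+1) times the isotone count. *)
have := schroder_sum k; rewrite -E mulnDr => /addIn Ek.
by rewrite /s_ big_mkord -natr_sum Ek natrM mulKf // pnatr_eq0.
Qed.
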